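(* Let $|\Psi\rangle,|\Psi'\rangle\in\mathcal{B}^n$ be $M$-party stabilizer states (with respect to the same distribution $n=\sum_{\alpha\in M}n_\alpha$ of qubits among the parties) which both have full local ranks, and let $S,S'\subset G^n$ be their stabilizer groups. Then $|\Psi\rangle$ is LCU-equivalent to $|\Psi'\rangle$ if and only if there exists a linear invertible map $T:S\to S'$ such that $\omega(T(f)_\alpha,T(g)_\alpha)=\omega(f_\alpha,g_\alpha)$ for all $f,g\in S$ and all $\alpha\in M$.
   Context: Let $G=\{00,01,10,11\}\cong\mathbb{F}_2^2$ and $G^n\cong\mathbb{F}_2^{2n}$, with elements written $f=(a_1,b_1,\dots,a_n,b_n)$. Put $\sigma_{00}=I$, $\sigma_{10}=\sigma^x$, $\sigma_{01}=\sigma^z$, $\sigma_{11}=\sigma^y$ and $\sigma(f)=\sigma_{a_1b_1}\otimes\cdots\otimes\sigma_{a_nb_n}$, an operator on $\mathcal{B}^n=(\mathbb{C}^2)^{\otimes n}$. The symplectic form is $\omega(f,f')=\sum_{j=1}^n(a_jb_j'+b_ja_j')\bmod 2$. For a subspace $S\subseteq G^n$, $S^\perp=\{f\in G^n:\omega(f,g)=0\ \forall g\in S\}$; $S$ is self-dual if $S^\perp=S$ (then $\dim S=n$). A stabilizer state with stabilizer group $S$ is, for a self-dual $S\subset G^n$ and a sign function $\epsilon:S\to\{\pm1\}$ for which the equations are consistent, the unique (up to global phase) unit vector $|\Psi\rangle$ with $\sigma(f)|\Psi\rangle=\epsilon(f)|\Psi\rangle$ for all $f\in S$. The Clifford group $\mathcal{C}(n)$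 is the set of unitaries $U$ on $\mathcal{B}^n$ such that $U\sigma(f)U^\dagger=\pm\sigma(u(f))$ for all $f\in G^n$ for some map $u:G^n\to G^n$. Multipartite setting: $M$ is a finite set of parties, $n=\sum_{\alpha\in M}n_\alpha$ with $n_\alpha\ge 0$, and party $\alpha$ holds $n_\alpha$ of the qubits. Accordingly $G^n=\bigoplus_{\alpha}G^{n_\alpha}$; for $f\in G^n$, $f_\alpha\in G^{n_\alpha}$ denotes the restriction of $f$ to the qubits of party $\alpha$, and $\omega(f_\alpha,g_\alpha)$ is the symplectic form of $G^{n_\alpha}$. For a subspace $S\subseteq G^n$, the local subspace is $S_\alpha=\{g\in S: g_\beta=0\text{ for all }\beta\neq\alpha\}$ and the co-local subspace is $S_{\hat\alpha}=\{g\in S:g_\alpha=0\}$ (if $n_\alpha=0$: $S_\alpha=0$, $S_{\hat\alpha}=S$). Two $M$-party stabilizer states $|\Psi\rangle,|\Psi'\rangle$ are LCU-equivalent if $|\Psi'\rangle=\bigotimes_{\alpha\in M}U_\alpha|\Psi\rangle$ (up to global phase) for some $U_\alpha\in\mathcal{C}(n_\alpha)$ acting on the qubits of party $\alpha$. A stabilizer state with stabilizer group $S$ has full local ranks if $S_\alpha=0$ for all $\alpha\in M$. *)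

(* Defs.v *)
From HB Require Import structures.
From mathcomp Require Import all_boot all_order all_algebra.
Set Implicit Arguments. Unset Strict Implicit. Unset Printing Implicit Defensive.
Import Order.TTheory GRing.Theory Num.Theory.
Local Open Scope ring_scope.

Notation G Q := {ffun Q -> 'F_2 * 'F_2}.

Section Qubits.
Variable C : numClosedFieldType.
Variable Q : finType.

(* computational basis of the qubits in Q: bit strings *)
Definition Bits := {ffun Q -> bool}.
(* vectors of B^Q = (C^2)^{\otimes Q} and operators on it *)
Definition Vec := Bits -> C.
Definition Op := Bits -> Bits -> C.

Definition opmul (A B : Op) : Op := fun x y => \sum_(z : Bits) A x z * B z y.
Definition adj (A : Op) : Op := fun x y => (A y x)^*.
Definition opid : Op := fun x y => (x == y)%:R.
Definition opapp (A : Op) (v : Vec) : Vec := fun x => \sum_(y : Bits) A x y * v y.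
Definition unitary (U : Op) : Prop :=
  forall x y, opmul U (adj U) x y = opid x y /\ opmul (adj U) U x y = opid x y.
Definition unit_vec (v : Vec) : Prop := \sum_(x : Bits) v x * (v x)^* = 1.


(* single-qubit Paulis: sigma_00 = I, sigma_10 = X, sigma_01 = Z, sigma_11 = Y,
   basis |0> = false, |1> = true; entry (row x, column y) *)
Definition sigma1 (a b : 'F_2) (x y : bool) : C :=
  if a == 0 then
    (if x == y then (if (b != 0) && x then -1 else 1) else 0)
  else
    (if x != y then (if b == 0 then 1 else if x then 'i else - 'i) else 0).

(* sigma(f) = tensor product of the sigma_{a_j b_j} *)
Definition sigma (f : G Q) : Op :=
  fun x y => \prod_(j : Q) sigma1 (f j).1 (f j).2 (x j) (y j).

Definition omega (f g : G Q) : 'F_2 :=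
  \sum_(j : Q) ((f j).1 * (g j).2 + (f j).2 * (g j).1).

Definition subspace (S : {set G Q}) : Prop :=
  0 \in S /\ forall f g, f \in S -> g \in S -> f + g \in S.
Definition perp (S : {set G Q}) : {set G Q} :=
  [set f | [forall g in S, omega f g == 0]].
Definition self_dual (S : {set G Q}) : Prop := subspace S /\ perp S = S.

Definition stabilizer_state (psi : Vec) (S : {set G Q}) : Prop :=
  self_dual S /\ unit_vec psi /\
  exists eps : G Q -> C,
    (forall f, f \in S -> eps f = 1 \/ eps f = -1) /\
    (forall f, f \in S -> forall x, opapp (sigma f) psi x = eps f * psi x).

Definition clifford (U : Op) : Prop :=
  unitary U /\
  forall f : G Q, exists (g : G Q) (s : bool),
    forall x y, opmul (opmul U (sigma f)) (adj U) x y = (-1) ^+ s * sigma g x y.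

End Qubits.

Arguments opapp {C Q}.
Arguments sigma {C Q}.

Section Parties.
Variable C : numClosedFieldType.
Variables (M : finType) (n : nat) (party : 'I_n -> M).

Definition PQ (al : M) : finType := {j : 'I_n | party j == al}.

Definition restrB (x : Bits 'I_n) (al : M) : Bits (PQ al) :=
  [ffun j : PQ al => x (val j)].
Definition restrG (f : G 'I_n) (al : M) : G (PQ al) :=
  [ffun j : PQ al => f (val j)].

Definition tens (U : forall al : M, Op C (PQ al)) : Op C 'I_n :=
  fun x y => \prod_(al : M) U al (restrB x al) (restrB y al).

Definition LCU_equiv (psi psi' : Vec C 'I_n) : Prop :=
  exists U : forall al : M, Op C (PQ al),
    (forall al, clifford (U al)) /\
    exists c : C, `|c| = 1 /\ forall x, psi' x = c * opapp (tens U) psi x.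

Definition local_sub (S : {set G 'I_n}) (al : M) : {set G 'I_n} :=
  [set g in S | [forall j, (party j != al) ==> (g j == 0)]].

Definition full_local_ranks (S : {set G 'I_n}) : Prop :=
  forall al : M, local_sub S al = [set (0 : G 'I_n)].

(* T is an F_2-linear bijection from S onto S' (over F_2, additivity is
   linearity) *)
Definition lin_iso (S S' : {set G 'I_n}) (T : G 'I_n -> G 'I_n) : Prop :=
  (forall f g, f \in S -> g \in S -> T (f + g) = T f + T g) /\
  {in S &, injective T} /\ T @: S = S'.

End Parties.

(* Main.v *)
Require Import Defs.
From Stdlib Require Import FunctionalExtensionality.
From mathcomp Require Import all_boot all_order all_algebra.
From mathcomp Require Import ring.
Set Implicit Arguments. Unset Strict Implicit. Unset Printing Implicit Defensive.
Import Order.TTheory GRing.Theory Num.Theory.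
Local Open Scope ring_scope.

(** Local Cliffords act on each G^(n_al) by maps preserving omega, which glue to
    the required T. Conversely, full local ranks mean that f |-> f_al maps S onto
    G^(n_al) (its image has trivial perp), so T induces an omega-preserving map
    u_al of the whole of G^(n_al), and no Witt-type extension is needed. Each u_al
    lifts to a Clifford unitary U_al. The tensor product of the U_al sends psi to a
    state stabilized by S' up to signs; a Pauli operator sigma(h) for which
    <psi', sigma(h) U psi> <> 0 corrects the signs, because eigenvectors with
    different eigenvalues are orthogonal. *)

Lemma F2_cases (a : 'F_2) : a = 0 \/ a = 1.
Proof. by case: a => [[|[|?]] ?] //; [left|right]; apply: val_inj. Qed.

(** * The symplectic form and maps preserving it *)

Section Symplectic.
Variable Q : finType.
Implicit Types f g h k : G Q.

Lemma omegaC f g : omega f g = omega g f.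
Proof. by apply: eq_bigr => j _; rewrite addrC mulrC [X in _ + X]mulrC. Qed.

Lemma omegaDl f g h : omega (f + g) h = omega f h + omega g h.
Proof. by rewrite -big_split; apply: eq_bigr => j _; rewrite !ffunE /=; ring. Qed.

Lemma omega0l f : omega 0 f = 0.
Proof. by apply: big1 => j _; rewrite ffunE /= !mul0r addr0. Qed.

Lemma omegaNl f g : omega (- f) g = - omega f g.
Proof. by apply/eqP; rewrite -addr_eq0 -omegaDl addNr omega0l. Qed.

Lemma omega_nondeg f : (forall k, omega f k = 0) -> f = 0.
Proof.
move=> f0; apply/ffunP => j; rewrite ffunE.
have proj (p : 'F_2 * 'F_2) : (f j).1 * p.2 + (f j).2 * p.1 = 0.
  (* The test vectors are supported on the single qubit [j]. *)
  have := f0 [ffun i => if i == j then p else 0].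
  rewrite /omega (bigD1 j) //= ffunE eqxx big1 ?addr0 // => i /negPf ij.
  by rewrite ffunE ij /= !mulr0 addr0.
have := proj (0, 1); have := proj (1, 0).
rewrite /= !mulr0 !mulr1 add0r addr0.
by case: (f j) => a b /= -> ->.
Qed.

(** The pairings of [f] with all [k] can be read off from [u f], and they determine [f] by
    nondegeneracy. No linearity of [u] is assumed. *)
Lemma omega_inj (u : G Q -> G Q) :
  (forall f g, omega (u f) (u g) = omega f g) -> injective u.
Proof.
move=> uP f g ufg; apply/eqP; rewrite -subr_eq0; apply/eqP.
by apply: omega_nondeg => k; rewrite omegaDl omegaNl -(uP f) -(uP g) ufg subrr.
Qed.

(** An injective self-map of a finite set is onto, so the defect of additivity may be tested against
    images [u k] only, where it pairs to zero. *)
Lemma omega_additive (u : G Q -> G Q) :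
  (forall f g, omega (u f) (u g) = omega f g) ->
  forall f g, u (f + g) = u f + u g.
Proof.
move=> uP f g; apply/eqP; rewrite -subr_eq0; apply/eqP.
have [v _ uv] := injF_bij (omega_inj uP).
apply: omega_nondeg => k; rewrite -(uv k).
by rewrite omegaDl omegaNl omegaDl !uP omegaDl subrr.
Qed.

End Symplectic.

(** * Matrix algebra, adjoints and inner products *)

Section Operators.
Variables (C : numClosedFieldType) (Q : finType).
Implicit Types (A B U V : Op C Q) (v w : Vec C Q) (f g h : G Q) (a b c : C).

Lemma op_ext A B : (forall x y, A x y = B x y) -> A = B.
Proof.
by move=> AB; apply: functional_extensionality => x;
  apply: functional_extensionality => y.
Qed.

Lemma vec_ext v w : (forall x, v x = w x) -> v = w.
Proof. exact: functional_extensionality. Qed.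

Definition opscale a A : Op C Q := fun x y => a * A x y.
Definition opadd A B : Op C Q := fun x y => A x y + B x y.
Definition vscale a v : Vec C Q := fun x => a * v x.
Definition inner v w : C := \sum_x (v x)^* * w x.

Lemma opmulA A B U : opmul A (opmul B U) = opmul (opmul A B) U.
Proof.
apply: op_ext => x y; rewrite /opmul.
under eq_bigr => z _ do rewrite big_distrr /=.
rewrite exchange_big; apply: eq_bigr => z _; rewrite big_distrl /=.
by apply: eq_bigr => t _; rewrite mulrA.
Qed.

Lemma opappM A B v : opapp (opmul A B) v = opapp A (opapp B v).
Proof.
apply: vec_ext => x; rewrite /opapp /opmul.
under [RHS]eq_bigr => z _ do rewrite big_distrr /=.
rewrite [RHS]exchange_big; apply: eq_bigr => z _; rewrite big_distrl /=.
by apply: eq_bigr => t _; rewrite mulrA.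
Qed.

Lemma opmul1l A : opmul (@opid C Q) A = A.
Proof.
apply: op_ext => x y; rewrite /opmul (bigD1 x) //= /opid eqxx mul1r.
by rewrite big1 ?addr0 // => z /negPf zx; rewrite eq_sym zx mul0r.
Qed.

Lemma opmul1r A : opmul A (@opid C Q) = A.
Proof.
apply: op_ext => x y; rewrite /opmul (bigD1 y) //= /opid eqxx mulr1.
by rewrite big1 ?addr0 // => z /negPf zx; rewrite zx mulr0.
Qed.

Lemma opapp1 v : opapp (@opid C Q) v = v.
Proof.
apply: vec_ext => x; rewrite /opapp (bigD1 x) //= /opid eqxx mul1r.
by rewrite big1 ?addr0 // => z /negPf zx; rewrite eq_sym zx mul0r.
Qed.

Lemma opmulZl a A B : opmul (opscale a A) B = opscale a (opmul A B).
Proof.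
apply: op_ext => x y; rewrite /opmul /opscale big_distrr /=.
by apply: eq_bigr => z _; rewrite mulrA.
Qed.

Lemma opmulZr a A B : opmul A (opscale a B) = opscale a (opmul A B).
Proof.
apply: op_ext => x y; rewrite /opmul /opscale big_distrr /=.
by apply: eq_bigr => z _; rewrite mulrCA.
Qed.

Lemma opscaleA a b A : opscale a (opscale b A) = opscale (a * b) A.
Proof. by apply: op_ext => x y; rewrite /opscale mulrA. Qed.

Lemma opscale1 A : opscale 1 A = A.
Proof. by apply: op_ext => x y; rewrite /opscale mul1r. Qed.

Lemma opscaleDr a A B : opscale a (opadd A B) = opadd (opscale a A) (opscale a B).
Proof. by apply: op_ext => x y; rewrite /opscale /opadd mulrDr. Qed.

Lemma opaddC A B : opadd A B = opadd B A.
Proof. by apply: op_ext => x y; rewrite /opadd addrC. Qed.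

Lemma opmulDl A B U : opmul (opadd A B) U = opadd (opmul A U) (opmul B U).
Proof.
apply: op_ext => x y; rewrite /opmul /opadd -big_split /=.
by apply: eq_bigr => z _; rewrite mulrDl.
Qed.

Lemma opmulDr A B U : opmul U (opadd A B) = opadd (opmul U A) (opmul U B).
Proof.
apply: op_ext => x y; rewrite /opmul /opadd -big_split /=.
by apply: eq_bigr => z _; rewrite mulrDr.
Qed.

Lemma opappZl a A v : opapp (opscale a A) v = vscale a (opapp A v).
Proof.
apply: vec_ext => x; rewrite /opapp /opscale /vscale big_distrr /=.
by apply: eq_bigr => z _; rewrite mulrA.
Qed.

Lemma opappZr a A v : opapp A (vscale a v) = vscale a (opapp A v).
Proof.
apply: vec_ext => x; rewrite /opapp /vscale big_distrr /=.
by apply: eq_bigr => z _; rewrite mulrCA.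
Qed.

Lemma opadjM A B : adj (opmul A B) = opmul (adj B) (adj A).
Proof.
apply: op_ext => x y; rewrite /adj /opmul rmorph_sum.
by apply: eq_bigr => z _; rewrite rmorphM mulrC.
Qed.

Lemma opadjZ a A : adj (opscale a A) = opscale a^* (adj A).
Proof. by apply: op_ext => x y; rewrite /adj /opscale rmorphM. Qed.

Lemma unitaryE U :
  unitary U <-> opmul U (adj U) = @opid C Q /\ opmul (adj U) U = @opid C Q.
Proof.
split=> [uU | [e1 e2] x y]; last by rewrite e1 e2.
by split; apply: op_ext => x y; have [] := uU x y.
Qed.

Lemma unitaryM U V : unitary U -> unitary V -> unitary (opmul U V).
Proof.
move=> /unitaryE [u1 u2] /unitaryE [v1 v2]; apply/unitaryE.
by rewrite opadjM -!opmulA (opmulA V) v1 opmul1l u1 (opmulA _ U) u2 opmul1l v2.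
Qed.

Lemma inner_adj v w A : inner v (opapp A w) = inner (opapp (adj A) v) w.
Proof.
rewrite /inner /opapp.
under eq_bigr => x _ do rewrite big_distrr /=.
rewrite exchange_big; apply: eq_bigr => y _; rewrite rmorph_sum big_distrl /=.
by apply: eq_bigr => x _; rewrite rmorphM /= conjCK; ring.
Qed.

Lemma innerZr a v w : inner v (vscale a w) = a * inner v w.
Proof.
by rewrite /inner big_distrr /=; apply: eq_bigr => x _; rewrite mulrCA.
Qed.

Lemma innerZl a v w : inner (vscale a v) w = a^* * inner v w.
Proof.
by rewrite /inner big_distrr /=; apply: eq_bigr => x _; rewrite rmorphM mulrA.
Qed.

Lemma innerBr v w1 w2 : inner v (fun x => w1 x - w2 x) = inner v w1 - inner v w2.
Proof. by rewrite /inner -sumrB; apply: eq_bigr => x _; rewrite mulrBr. Qed.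

Lemma unit_vecE v : unit_vec v <-> inner v v = 1.
Proof.
rewrite /unit_vec /inner.
by under eq_bigr => x _ do rewrite mulrC.
Qed.

Lemma inner_unitary U v w : unitary U -> inner (opapp U v) (opapp U w) = inner v w.
Proof. by move=> /unitaryE [_ U1]; rewrite inner_adj -opappM U1 opapp1. Qed.

End Operators.

(** * The nontrivial additive character of the field with two elements *)

Section Sign.
Variable R : numDomainType.

Definition psign (a : 'F_2) : R := (-1) ^+ (a != 0).

Lemma psign0 : psign 0 = 1.
Proof. by rewrite /psign eqxx. Qed.

Lemma psignD a b : psign (a + b) = psign a * psign b.
Proof.
by case: (F2_cases a) => ->; case: (F2_cases b) => ->; rewrite /psign /=; ring.
Qed.

Lemma psignV a : psign a * psign a = 1.
Proof. by rewrite -expr2 sqrr_sign. Qed.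

Lemma psign_inj : injective psign.
Proof.
have n1 : (1 == -1 :> R) = false by rewrite -addr_eq0 -mulr2n pnatr_eq0.
move=> a b; case: (F2_cases a) => ->; case: (F2_cases b) => -> //.
  by rewrite /psign /= expr0 expr1 => /eqP; rewrite n1.
by rewrite /psign /= expr0 expr1 => /eqP; rewrite eq_sym n1.
Qed.

Lemma psign_eqN1 a : a != 0 -> psign a = -1.
Proof. by rewrite /psign => ->. Qed.

Lemma psign_sum (I : finType) (F : I -> 'F_2) :
  psign (\sum_i F i) = \prod_i psign (F i).
Proof. exact: (big_morph psign psignD psign0). Qed.

End Sign.

(** * Subspaces with trivial perp, by character sums *)

Section SymplecticPerp.
Variable Q : finType.
Implicit Types (f g h k : G Q) (W : {set G Q}).

Lemma addff f : f + f = 0.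
Proof.
apply/ffunP => j; rewrite !ffunE; case: (f j) => a b.
by case: (F2_cases a) => ->; case: (F2_cases b) => ->; apply/eqP.
Qed.

(** Translation by [f] permutes [W] and flips the sign of every term. *)
Lemma char_sum_eq0 W h f : subspace W -> f \in W -> omega f h != 0 ->
  \sum_(w in W) psign int (omega w h) = 0.
Proof.
move=> [_ WD] Wf fh; set s := (X in X = 0).
suff: s = - s by move/eqP; rewrite -addr_eq0 -mulr2n mulrn_eq0 => /eqP.
rewrite {1}/s -sumrN (reindex_inj (addrI f)) /=.
apply: eq_big => [w|w _]; last by rewrite omegaDl psignD psign_eqN1 // mulN1r.
apply/idP/idP => [/(WD _ _ Wf)|/(WD _ _ Wf) //].
by rewrite addrA addff add0r.
Qed.

Lemma omega_neq0 f : f != 0 -> exists k, omega f k != 0.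
Proof.
move=> f0; apply/existsP; apply: contraNT f0 => /existsPn f0.
by apply/eqP/omega_nondeg => k; apply/eqP/negbNE.
Qed.

(* Evaluate sum_h sum_(w in W) (-1)^omega(w + k, h) in both orders. *)
Lemma perp0_full W : subspace W -> perp W = [set (0 : G Q)] -> W = setT.
Proof.
move=> Wsub W0; apply/setP => k; rewrite inE; apply/negPn/negP => kW.
have Tsub : subspace [set: G Q] by split=> *; rewrite inE.
have : \sum_(w in W) \sum_(h in setT) psign int (omega h (w + k)) = 0.
  apply: big1 => w Ww; have [|h hw] := @omega_neq0 (w + k).
    apply: contraNneq kW => wk.
    by rewrite -[k]add0r -(addff w) -addrA wk addr0.
  by rewrite (char_sum_eq0 (f := h)) ?inE // omegaC.
(* The term at [h = 0] is the cardinality of [W]. Any other [h] lies outside [perp W], so its sum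
   over [W] vanishes. Hence [W] would be empty, although it contains 0. *)
rewrite exchange_big /= (bigD1 (0 : G Q)) ?inE //= [X in _ + X]big1 => [|h /andP [_ h0]].
  under eq_bigr => w _ do rewrite omega0l psign0.
  rewrite sumr_const addr0 => /eqP; rewrite pnatr_eq0 cards_eq0 => /eqP We.
  by case: Wsub; rewrite We inE.
have /forall_inPn [w Ww hw] : ~~ [forall w in W, omega h w == 0].
  by have := h0; rewrite -in_set1 -W0 inE.
under eq_bigr => v _ do rewrite omegaC omegaDl psignD.
by rewrite -big_distrl /= (char_sum_eq0 Wsub Ww) ?mul0r // omegaC.
Qed.

End SymplecticPerp.

(** * Single-qubit Pauli identities *)

Section Pauli.
Variables (C : numClosedFieldType).

Lemma sigma1_comm (a b a' b' : 'F_2) (x y : bool) :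
  \sum_z sigma1 C a b x z * sigma1 C a' b' z y
  = psign C (a * b' + b * a') * \sum_z sigma1 C a' b' x z * sigma1 C a b z y.
Proof.
rewrite !big_bool.
by case: (F2_cases a) => ->; case: (F2_cases b) => ->; case: (F2_cases a') => ->;
  case: (F2_cases b') => ->; case: x; case: y; rewrite /psign /sigma1 /=; ring.
Qed.

Lemma sigma1_sqr (a b : 'F_2) (x y : bool) :
  \sum_z sigma1 C a b x z * sigma1 C a b z y = (x == y)%:R.
Proof.
have ii : 'i * 'i = -1 :> C by rewrite -expr2 sqrCi.
rewrite big_bool.
by case: (F2_cases a) => ->; case: (F2_cases b) => ->; case: x; case: y;
  rewrite /sigma1 /= ?mulrN ?mulNr ?ii; ring.
Qed.

Lemma sigma1_herm (a b : 'F_2) (x y : bool) :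
  (sigma1 C a b y x)^* = sigma1 C a b x y.
Proof.
by case: (F2_cases a) => ->; case: (F2_cases b) => ->; case: x; case: y;
  rewrite /sigma1 /= ?rmorphN /= ?conjCi ?rmorph1 ?rmorph0 ?opprK.
Qed.

(** Completeness relation: the four Pauli matrices form an orthogonal basis of the 2 by 2
    matrices. *)
Lemma sigma1_complete (x y p q : bool) :
  \sum_(k : 'F_2 * 'F_2) sigma1 C k.1 k.2 x y * (sigma1 C k.1 k.2 p q)^*
  = 2 * ((x == p) && (y == q))%:R.
Proof.
have ii : 'i * 'i = -1 :> C by rewrite -expr2 sqrCi.
rewrite -(pair_bigA _ (fun a b => sigma1 C a b x y * (sigma1 C a b p q)^*)) /=.
rewrite !big_ord_recl !big_ord0 /=.
have -> : lift ord0 ord0 = 1 :> 'F_2 by apply: val_inj.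
have -> : ord0 = 0 :> 'F_2 by [].
by case: x; case: y; case: p; case: q;
  rewrite /sigma1 /= ?rmorphN /= ?conjCi ?rmorph1 ?rmorph0 ?mulrN ?mulNr ?ii; ring.
Qed.

End Pauli.

Lemma prod_natr_bool (R : comNzRingType) (I : finType) (b : pred I) :
  \prod_j (b j)%:R = ([forall j, b j])%:R :> R.
Proof.
case: forallP => [bT|bF]; first by apply: big1 => j _; rewrite bT.
have /forallPn [j /negPf bj] : ~~ [forall j, b j] by apply/forallP.
by rewrite (bigD1 j) //= bj mul0r.
Qed.

Lemma ffun_eqE (I : finType) (T : eqType) (x y : {ffun I -> T}) :
  (x == y) = [forall j, x j == y j].
Proof.
apply/eqP/forallP => [-> j //|xy]; apply/ffunP => j; exact/eqP.
Qed.

(** * Pauli operators on many qubits and their completeness *)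

Section PauliGroup.
Variables (C : numClosedFieldType) (Q : finType).
Implicit Types (A B U V : Op C Q) (v w : Vec C Q) (f g h : G Q).
Local Notation sigma := (@sigma C Q).

Lemma sigma_mulE f g x y : opmul (sigma f) (sigma g) x y =
  \prod_j \sum_z sigma1 C (f j).1 (f j).2 (x j) z * sigma1 C (g j).1 (g j).2 z (y j).
Proof.
by rewrite bigA_distr_bigA; apply: eq_bigr => z _; rewrite -big_split.
Qed.

Lemma sigma_comm f g :
  opmul (sigma f) (sigma g)
  = opscale (psign C (omega f g)) (opmul (sigma g) (sigma f)).
Proof.
apply: op_ext => x y; rewrite /opscale !sigma_mulE psign_sum -big_split /=.
by apply: eq_bigr => j _; rewrite sigma1_comm.
Qed.

Lemma sigma_sqr f : opmul (sigma f) (sigma f) = @opid C Q.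
Proof.
apply: op_ext => x y; rewrite sigma_mulE /opid ffun_eqE -prod_natr_bool.
by apply: eq_bigr => j _; rewrite sigma1_sqr.
Qed.

Lemma sigma_herm f : adj (sigma f) = sigma f.
Proof.
apply: op_ext => x y; rewrite /adj rmorph_prod /=.
by apply: eq_bigr => j _; rewrite sigma1_herm.
Qed.

Lemma sigma_complete x y p q :
  \sum_h sigma h x y * (sigma h p q)^* = 2 ^+ #|Q| * ((x == p) && (y == q))%:R.
Proof.
transitivity (\prod_(j : Q) (2 * ((x j == p j) && (y j == q j))%:R) : C).
  under [RHS]eq_bigr => j _ do rewrite -sigma1_complete.
  rewrite bigA_distr_bigA; apply: eq_bigr => h _.
  by rewrite rmorph_prod -big_split.
rewrite big_split prodr_const /= prod_natr_bool !ffun_eqE; congr (_ * _%:R).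
congr (nat_of_bool _); apply/forallP/andP => [xy|[/forallP xp /forallP yq] j].
  by split; apply/forallP => j; case/andP: (xy j).
by rewrite xp yq.
Qed.

Lemma pow2_neq0 (n : nat) : 2 ^+ n != 0 :> C.
Proof. by rewrite expf_neq0 // pnatr_eq0. Qed.

(** Schur's lemma for the Pauli operators. By completeness they span all operators, so [A] commutes
    with every matrix unit; [E] is the entry at [x], [y] of this commutation with the unit at [p],
    [q]. *)
Lemma pauli_commutant A :
  (forall f, opmul A (sigma f) = opmul (sigma f) A) ->
  exists c, A = opscale c (@opid C Q).
Proof.
move=> Acomm.
have E x y p q : A x p * (y == q)%:R = (x == p)%:R * A q y.
  apply: (mulfI (pow2_neq0 #|Q|)).
  transitivity (\sum_h opmul A (sigma h) x y * (sigma h p q)^*).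
    rewrite /opmul; under eq_bigr => h _ do rewrite big_distrl /=.
    rewrite exchange_big (bigD1 p) //= [X in _ + X]big1 => [|z /negPf zp].
      under eq_bigr => h _ do rewrite -mulrA.
      by rewrite -big_distrr sigma_complete eqxx addr0 /=; ring.
    under eq_bigr => h _ do rewrite -mulrA.
    by rewrite -big_distrr sigma_complete zp /=; ring.
  transitivity (\sum_h opmul (sigma h) A x y * (sigma h p q)^*).
    by apply: eq_bigr => h _; rewrite Acomm.
  rewrite /opmul; under eq_bigr => h _ do rewrite big_distrl /=.
  rewrite exchange_big (bigD1 q) //= [X in _ + X]big1 => [|z /negPf zq].
    under eq_bigr => h _ do rewrite mulrAC.
    by rewrite -big_distrl sigma_complete eqxx andbT addr0 /=; ring.
  under eq_bigr => h _ do rewrite mulrAC.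
  by rewrite -big_distrl sigma_complete zq andbF /=; ring.
pose o : Bits Q := [ffun=> false].
exists (A o o); apply: op_ext => x p; rewrite /opscale /opid.
by have := E x o p o; rewrite eqxx mulr1 mulrC.
Qed.

(** Weighting the equation for [h] by the conjugate of [sigma h p q] and summing over [h] leaves
    [2 ^+ #|Q| * (v p)^* * w q], where [v p] is nonzero and [q] is arbitrary. *)
Lemma pauli_cyclic v w :
  (exists p, v p != 0) -> (forall h, inner v (opapp (sigma h) w) = 0) ->
  forall x, w x = 0.
Proof.
move=> [p vp] vw q.
have : \sum_h (sigma h p q)^* * inner v (opapp (sigma h) w) = 0.
  by apply: big1 => h _; rewrite vw mulr0.
have -> : \sum_h (sigma h p q)^* * inner v (opapp (sigma h) w)
        = \sum_x \sum_y (v x)^* * w y * \sum_h sigma h x y * (sigma h p q)^*.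
  rewrite /inner /opapp; under eq_bigr => h _ do rewrite big_distrr /=.
  rewrite exchange_big; apply: eq_bigr => x _.
  under eq_bigr => h _ do rewrite !big_distrr /=.
  rewrite exchange_big; apply: eq_bigr => y _; rewrite big_distrr /=.
  by apply: eq_bigr => h _; ring.
rewrite (bigD1 p) //= [X in _ + X]big1 => [|x /negPf xp]; last first.
  by apply: big1 => y _; rewrite sigma_complete xp !mulr0.
rewrite addr0 (bigD1 q) //= [X in _ + X]big1 => [|y /negPf yq]; last first.
  by rewrite sigma_complete yq andbF !mulr0.
rewrite sigma_complete !eqxx addr0 mulr1 => /eqP.
by rewrite !mulf_eq0 (negPf (pow2_neq0 _)) conjC_eq0 (negPf vp) orbF => /eqP.
Qed.

End PauliGroup.

(** * Clifford operators and the lifting of symplectic maps *)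

Section Cliffords.
Variables (C : numClosedFieldType) (Q : finType).
Implicit Types (A B U V : Op C Q) (v w : Vec C Q) (f g h : G Q) (b : bool).
Implicit Types (u : G Q -> G Q).
Local Notation sigma := (@sigma C Q).
Local Notation opid := (@opid C Q).

Lemma sign_sqr b : (-1) ^+ b * (-1) ^+ b = 1 :> C.
Proof. by rewrite -expr2 sqrr_sign. Qed.

Lemma psign_bool a : exists b, psign C a = (-1) ^+ b.
Proof. by exists (a != 0). Qed.

Lemma sign_conj b : ((-1) ^+ b)^* = (-1) ^+ b :> C.
Proof. by rewrite rmorph_sign. Qed.

Lemma sigma_unitary f : unitary (sigma f).
Proof. by apply/unitaryE; rewrite sigma_herm sigma_sqr. Qed.

(** For unitary [U] this says that conjugation by [U] sends [sigma f] to [sigma g] up to sign.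
    Stated without the adjoint, it also applies to operators not yet known to be unitary. *)
Definition intertwines U f g : Prop :=
  exists b, opmul (sigma g) U = opscale ((-1) ^+ b) (opmul U (sigma f)).

Lemma cliffordE U :
  clifford U <-> unitary U /\ forall f, exists g, intertwines U f g.
Proof.
split=> -[uU H]; split=> // f; case/unitaryE: (uU) => U1 U2.
  have [g [b e]] := H f; exists g, b.
  have -> : opmul U (sigma f) = opscale ((-1) ^+ b) (opmul (sigma g) U).
    rewrite -opmulZl -[LHS]opmul1r -U2 opmulA; congr (opmul _ _).
    by apply: op_ext => x y; rewrite e.
  by rewrite opscaleA sign_sqr opscale1.
have [g [b e]] := H f; exists g, b => x y.
have -> : opmul U (sigma f) = opscale ((-1) ^+ b) (opmul (sigma g) U).
  by rewrite e opscaleA sign_sqr opscale1.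
by rewrite opmulZl -opmulA U1 opmul1r.
Qed.

Lemma intertwinesM U V f g h :
  intertwines V f g -> intertwines U g h -> intertwines (opmul U V) f h.
Proof.
move=> [b1 e1] [b2 e2]; exists (b1 (+) b2).
by rewrite opmulA e2 opmulZl -opmulA e1 opmulZr opscaleA opmulA signr_addb mulrC.
Qed.

Lemma sigma_intertwines h f : intertwines (sigma h) f f.
Proof.
by have [b e] := psign_bool (omega f h); exists b; rewrite sigma_comm e.
Qed.

Lemma cliffordM U V : clifford U -> clifford V -> clifford (opmul U V).
Proof.
move=> /cliffordE [uU HU] /cliffordE [uV HV]; apply/cliffordE.
split=> [|f]; first exact: unitaryM.
have [g fg] := HV f; have [h gh] := HU g; exists h.
exact: intertwinesM fg gh.
Qed.

Lemma clifford_sigma h : clifford (sigma h).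
Proof.
apply/cliffordE; split=> [|f]; first exact: sigma_unitary.
by exists f; apply: sigma_intertwines.
Qed.

Lemma sigma_neq0 f : exists x y, sigma f x y != 0.
Proof.
pose o : Bits Q := [ffun=> false].
have: opmul (sigma f) (sigma f) o o != 0.
  by rewrite sigma_sqr /opid eqxx oner_eq0.
rewrite /opmul => s0; exists o.
apply/existsP; apply: contraNT s0 => /existsPn s0.
by apply/eqP; apply: big1 => z _; rewrite (eqP (negbNE (s0 z))) mul0r.
Qed.

Lemma unitary_neq0 U V : unitary U -> (exists x y, V x y != 0) ->
  exists x y, opmul V U x y != 0.
Proof.
move=> /unitaryE [U1 _] [x [y]] Vxy; exists x; apply/existsP.
apply: contraNT Vxy => /existsPn s0; rewrite -[V]opmul1r -U1 opmulA.
by apply/eqP; apply: big1 => z _; rewrite (eqP (negbNE (s0 z))) mul0r.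
Qed.

(** The commutation signs of [g], [g'] and of [f], [f'] multiply the same nonzero operator
    [sigma g' sigma g U], so they agree. *)
Lemma intertwines_omega U f f' g g' : unitary U ->
  intertwines U f g -> intertwines U f' g' -> omega g g' = omega f f'.
Proof.
move=> uU [b e] [b' e'].
have gg' : opmul (opmul (sigma g) (sigma g')) U =
    opscale ((-1) ^+ b' * (-1) ^+ b) (opmul U (opmul (sigma f) (sigma f'))).
  by rewrite -opmulA e' opmulZr opmulA e opmulZl opscaleA opmulA.
have g'g : opmul (opmul (sigma g') (sigma g)) U =
    opscale ((-1) ^+ b' * (-1) ^+ b) (opmul U (opmul (sigma f') (sigma f))).
  by rewrite -opmulA e opmulZr opmulA e' opmulZl opscaleA opmulA mulrC.
have [] := unitary_neq0 uU (unitary_neq0 (sigma_unitary g) (sigma_neq0 g')).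
move=> x [y nz]; apply: (@psign_inj C); apply: (mulIf nz).
have /(congr1 (fun A => A x y)) := gg'.
rewrite sigma_comm opmulZl {1}/opscale => ->.
rewrite sigma_comm opmulZr g'g /opscale; ring.
Qed.

Definition twist u f A : Op C Q := opmul (opmul (sigma (u f)) A) (sigma f).

(** Swapping the Pauli factors on the left and on the right of [A] costs the signs of
    [omega (u f) (u g)] and [omega g f], which are equal and cancel. *)
Lemma twist_comm u f g A : (forall f g, omega (u f) (u g) = omega f g) ->
  twist u f (twist u g A) = twist u g (twist u f A).
Proof.
move=> uP; rewrite /twist.
transitivity (opmul (opmul (opmul (sigma (u f)) (sigma (u g))) A)
                    (opmul (sigma g) (sigma f))); first by rewrite !opmulA.
rewrite (sigma_comm C (u f)) uP (sigma_comm C g) !(opmulZl, opmulZr) opscaleA.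
by rewrite (omegaC g) psignV opscale1 !opmulA.
Qed.

Lemma twistK u f A : twist u f (twist u f A) = A.
Proof.
rewrite /twist !opmulA sigma_sqr opmul1l -opmulA sigma_sqr.
exact: opmul1r.
Qed.

Lemma twistZ u f (c : C) A : twist u f (opscale c A) = opscale c (twist u f A).
Proof. by rewrite /twist opmulZr opmulZl. Qed.

Lemma twistD u f A B : twist u f (opadd A B) = opadd (twist u f A) (twist u f B).
Proof. by rewrite /twist opmulDr opmulDl. Qed.

(** Simultaneous diagonalization of commuting involutions, by induction on [s] and starting from the
    identity operator. *)
Lemma twist_eigen u (s : seq (G Q)) : (forall f g, omega (u f) (u g) = omega f g) ->
  exists A, (exists x y, A x y != 0) /\
    forall f, f \in s -> exists b, twist u f A = opscale ((-1) ^+ b) A.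
Proof.
move=> uP; elim: s => [|f s [A [A0 As]]].
  by exists opid; split=> //; have := sigma_neq0 0; exists [ffun=> false], [ffun=> false];
    rewrite /opid eqxx oner_eq0.
(* [B] is, up to a factor 2, the projection of [A] onto the +1 eigenspace of the new involution. If
   it is nonzero it replaces [A], keeping the old eigenvalues by commutation; if it is zero, [A]
   itself has eigenvalue -1. *)
pose B := opadd A (twist u f A).
have [/existsP [x /existsP [y Bxy]]|/existsPn B0] :=
    boolP [exists x, [exists y, B x y != 0]].
  exists B; split=> [|g]; first by exists x, y.
  rewrite inE => /predU1P [->|/As [b e]].
    by exists false; rewrite opscale1 twistD twistK opaddC.
  by exists b; rewrite twistD twist_comm // e twistZ opscaleDr.
exists A; split=> // g; rewrite inE => /predU1P [->|/As //].
exists true; apply: op_ext => x y; rewrite /opscale expr1 mulN1r.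
have /existsPn /(_ y) /negbNE := B0 x.
by rewrite /B /opadd addrC addr_eq0 => /eqP.
Qed.

(* A common eigenvector A of the commuting involutions A |-> sigma(u f) A sigma(f)
   satisfies sigma(u f) A = +-A sigma(f); then A^*A and AA^* commute with all
   Pauli operators, so A is a multiple of a unitary. *)
Lemma clifford_lift u : (forall f g, omega (u f) (u g) = omega f g) ->
  exists U, clifford U /\ forall f, intertwines U f (u f).
Proof.
move=> uP; have [A [[p [q Apq]] Ae]] := twist_eigen (enum (G Q)) uP.
have [v _ uv] := injF_bij (omega_inj uP).
have AP f : intertwines A f (u f).
  have [|b e] := Ae f; first by rewrite mem_enum.
  exists b; rewrite -opmulZl -e /twist -opmulA sigma_sqr.
  by rewrite opmul1r.
have [c Ec] : exists c, opmul (adj A) A = opscale c opid.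
  apply: pauli_commutant => f; have [b e] := AP f.
  have e' := congr1 (@adj C Q) e; rewrite opadjZ sign_conj !opadjM !sigma_herm in e'.
  have E : opmul A (sigma f) = opscale ((-1) ^+ b) (opmul (sigma (u f)) A).
    by rewrite e opscaleA sign_sqr opscale1.
  rewrite -opmulA E opmulZr opmulA e' opmulZl opscaleA sign_sqr opscale1.
  by rewrite opmulA.
have [c' Ec'] : exists c, opmul A (adj A) = opscale c opid.
  (* As [u] is onto, every Pauli operator has the form [sigma (u f)]. *)
  apply: pauli_commutant => g; rewrite -(uv g); move: (v g) => f.
  have [b e] := AP f.
  have e' := congr1 (@adj C Q) e; rewrite opadjZ sign_conj !opadjM !sigma_herm in e'.
  rewrite -opmulA e' opmulZr [RHS]opmulA e opmulZl.
  by rewrite opmulA.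
have cc' : c' = c.
  apply: (mulIf Apq).
  have : opmul (opmul A (adj A)) A = opmul A (opmul (adj A) A) by rewrite opmulA.
  rewrite Ec Ec' opmulZl opmulZr opmul1l opmul1r.
  by move/(congr1 (fun A => A p q)).
have c_gt0 : 0 < c.
  have := congr1 (fun A => A q q) Ec; rewrite /opmul /opscale /opid eqxx mulr1 => <-.
  rewrite (bigD1 p) //= ltr_wpDr ?sumr_ge0 // /adj => [x _|].
    by rewrite mulrC mul_conjC_ge0.
  by rewrite mulrC mul_conjC_gt0.
(* The scalar [c] is the squared norm of column [q] of [A], positive because [A p q] is nonzero;
   dividing by its root makes [A] unitary. *)
pose r := (sqrtC c)^-1.
have r2 : r * r * c = 1.
  by rewrite -[c]sqrtCK /r; field; rewrite sqrtC_eq0 lt0r_neq0.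
have rr : r^* = r by apply: geC0_conj; rewrite invr_ge0 sqrtC_ge0 ltW.
have rP f : intertwines (opscale r A) f (u f).
  have [b e] := AP f; exists b.
  by rewrite opmulZr e opmulZl !opscaleA mulrC.
exists (opscale r A); split=> //; apply/cliffordE; split=> [|f].
  apply/unitaryE; rewrite opadjZ rr !(opmulZl, opmulZr) Ec Ec' cc' !opscaleA.
  by rewrite r2 opscale1.
by exists (u f).
Qed.

End Cliffords.

(** * Splitting labels and bit strings among the parties *)

Section PartySplitting.
Variables (M : finType) (n : nat) (party : 'I_n -> M).
Local Notation PQ := (PQ party).
Local Notation restrG := (restrG party).
Local Notation restrB := (restrB party).
Implicit Types (f g : G 'I_n) (S : {set G 'I_n}) (al : M).

Lemma big_party (R : Type) (idx : R) (op : Monoid.com_law idx) (F : 'I_n -> R) :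
  \big[op/idx]_j F j = \big[op/idx]_al \big[op/idx]_(j : PQ al) F (val j).
Proof.
rewrite (partition_big party xpredT) //; apply: eq_bigr => al _ /=.
exact: (big_sub (fun j => party j == al)).
Qed.

(** [T] is left free so that one gluing serves both bit strings and Pauli labels. *)
Definition glue (T : Type) (x : forall al, {ffun PQ al -> T}) : {ffun 'I_n -> T} :=
  [ffun j => x (party j) (Sub j (eqxx (party j)))].

Lemma glueK (T : Type) (x : forall al, {ffun PQ al -> T}) al :
  [ffun j : PQ al => glue x (val j)] = x al.
Proof.
apply/ffunP => -[j ej]; rewrite !ffunE /=; have jal := eqP ej.
(* Replacing [al] by [party j] aligns the dependent types; the two indices then differ at most in
   their membership proofs. *)
by case: al / jal ej => ej; congr (x _ _); apply: val_inj.
Qed.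

Lemma restrG_glue (x : forall al, G (PQ al)) al : restrG (glue x) al = x al.
Proof. exact: glueK. Qed.

Lemma restrB_glue (x : forall al, Bits (PQ al)) al : restrB (glue x) al = x al.
Proof. exact: glueK. Qed.

Lemma restrB_inj (x y : Bits 'I_n) : (forall al, restrB x al = restrB y al) -> x = y.
Proof.
move=> xy; apply/ffunP => j.
by have /ffunP /(_ (Sub j (eqxx (party j)))) := xy (party j); rewrite !ffunE.
Qed.

Lemma restrGD f g al : restrG (f + g) al = restrG f al + restrG g al.
Proof. by apply/ffunP => j; rewrite !ffunE. Qed.

Lemma restrG0 al : restrG 0 al = 0.
Proof. by apply/ffunP => j; rewrite !ffunE. Qed.

Lemma omega_party f g : omega f g = \sum_al omega (restrG f al) (restrG g al).
Proof.
rewrite /omega big_party; apply: eq_bigr => al _.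
by apply: eq_bigr => j _; rewrite !ffunE.
Qed.

(** Distributivity when the summation type varies with the party. The sums pass to tagged pairs,
    where the non-dependent law applies, and return through [fprod]; [glue] identifies families of
    local strings with global strings. *)
Lemma sum_party_prod (R : comNzRingType) (F : forall al, Bits (PQ al) -> R) :
  \prod_al \sum_(w : Bits (PQ al)) F al w =
  \sum_(z : Bits 'I_n) \prod_al F al (restrB z al).
Proof.
rewrite (eq_bigr _ (fun al _ => big_tag (T_ := fun al => Bits (PQ al)) F al)) /=.
rewrite bigA_distr_big_dep /=.
transitivity (\sum_(t : fprod (fun al => Bits (PQ al)))
  \prod_al [ffun w => F al w] (t al)).
  rewrite big_fprod; apply: eq_bigr => g gP; apply: eq_bigr => al _.
  by congr untag; apply: functional_extensionality => w; rewrite ffunE.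
rewrite (reindex (fun z => fprod_of_fun (restrB z))) /=; last first.
  exists (fun t : fprod (fun al => Bits (PQ al)) => glue t) => [z _|t _].
    by apply: restrB_inj => al; rewrite restrB_glue fprodE.
  by apply/fprodP => al; rewrite fprodE restrB_glue.
by apply: eq_bigr => z _; apply: eq_bigr => al _; rewrite ffunE fprodE.
Qed.

Definition extG al (g : G (PQ al)) : G 'I_n :=
  [ffun j => oapp g 0 (insub j)].

Lemma restrG_ext al (g : G (PQ al)) : restrG (extG g) al = g.
Proof. by apply/ffunP => j; rewrite !ffunE valK. Qed.

Lemma extG_out al (g : G (PQ al)) j : party j != al -> extG g j = 0.
Proof. by move=> jal; rewrite ffunE insubN. Qed.

(** Only party [al] contributes, which makes extension by zero adjoint to restriction. *)
Lemma omega_ext al (g : G (PQ al)) f : omega (extG g) f = omega g (restrG f al).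
Proof.
rewrite omega_party (bigD1 al) //= restrG_ext big1 ?addr0 // => be bal.
rewrite (_ : restrG _ be = 0) ?omega0l //.
apply/ffunP => j; rewrite ffunE extG_out ?ffunE //.
by rewrite (eqP (valP j)).
Qed.

(** A vector orthogonal to the image, extended by zero, is orthogonal to [S], so it lies in
    [perp S = S] and therefore in the local subspace, which is zero. *)
Lemma restrG_onto S al : self_dual S -> full_local_ranks party S ->
  forall k, exists2 f, f \in S & restrG f al = k.
Proof.
move=> [[S0 SD] Sperp] Sloc k.
have Wsub : subspace [set restrG f al | f in S].
  split=> [|_ _ /imsetP [f Sf ->] /imsetP [g Sg ->]].
    by apply/imsetP; exists 0; rewrite ?restrG0.
  by rewrite -restrGD imset_f // SD.
suff /perp0_full -/(_ Wsub) /setP /(_ k) :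
    perp [set restrG f al | f in S] = [set (0 : G (PQ al))].
  by rewrite inE => /imsetP [f Sf ->]; exists f.
apply/setP => h; rewrite !inE; apply/forall_inP/eqP => [hW|-> f _]; last first.
  by rewrite omega0l.
have : extG h \in local_sub party S al.
  rewrite inE -{1}Sperp inE; apply/andP; split.
    by apply/forall_inP => f Sf; rewrite omega_ext hW ?imset_f.
  by apply/forallP => j; apply/implyP => /extG_out ->.
by rewrite Sloc inE => /eqP h0; rewrite -(restrG_ext h) h0 restrG0.
Qed.

End PartySplitting.

(** * Tensor products of local operators *)

Section LocalOperators.
Variables (C : numClosedFieldType) (M : finType) (n : nat) (party : 'I_n -> M).
Local Notation PQ := (PQ party).
Local Notation restrG := (restrG party).
Local Notation tens := (@tens C M n party).
Implicit Types (U V : forall al, Op C (PQ al)) (f g : G 'I_n).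

Lemma sigma_tens f : @sigma C _ f = tens (fun al => sigma (restrG f al)).
Proof.
apply: op_ext => x y; rewrite /sigma (big_party party).
by apply: eq_bigr => al _; apply: eq_bigr => j _; rewrite !ffunE.
Qed.

Lemma tensM U V : opmul (tens U) (tens V) = tens (fun al => opmul (U al) (V al)).
Proof.
apply: op_ext => x y; rewrite /tens.
rewrite (sum_party_prod (fun al w =>
  U al (restrB party x al) w * V al w (restrB party y al))).
by apply: eq_bigr => z _; rewrite -big_split.
Qed.

Lemma tens_adj U : adj (tens U) = tens (fun al => adj (U al)).
Proof. by apply: op_ext => x y; rewrite /adj /tens rmorph_prod. Qed.

Lemma eq_tens U V : (forall al, U al = V al) -> tens U = tens V.
Proof. by move=> UV; apply: op_ext => x y; apply: eq_bigr => al _; rewrite UV. Qed.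

Lemma tens1 : tens (fun al => @opid C (PQ al)) = @opid C _.
Proof.
(* The identity is written as the square of [sigma 0], because Pauli operators are already known to
   factor over the parties. *)
rewrite -(sigma_sqr C 0) sigma_tens tensM.
by apply: eq_tens => al; rewrite sigma_sqr.
Qed.

Lemma tens_unitary U : (forall al, unitary (U al)) -> unitary (tens U).
Proof.
move=> uU; apply/unitaryE; rewrite tens_adj !tensM -tens1.
by split; apply: eq_tens => al; have /unitaryE [] := uU al.
Qed.

Lemma tens_intertwines U f g :
  (forall al, intertwines (U al) (restrG f al) (restrG g al)) -> intertwines (tens U) f g.
Proof.
(* The global sign is the product of the local ones, hence the parity of their exponents. *)
move=> /fin_all_exists [b e]; exists (\big[addb/false]_al b al).
rewrite !sigma_tens !tensM (eq_tens e).
apply: op_ext => x y; rewrite /tens /opscale big_split /=; congr (_ * _).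
by symmetry; apply: (big_morph (fun b : bool => (-1) ^+ b)) => // b1 b2;
  rewrite signr_addb.
Qed.

End LocalOperators.

(** * Joint eigenvectors and uniqueness of stabilizer states *)

Section StabilizerStates.
Variables (C : numClosedFieldType) (Q : finType).
Implicit Types (A B U V : Op C Q) (v w : Vec C Q) (f g h : G Q) (S : {set G Q}).
Local Notation sigma := (@sigma C Q).

(** Both orders of the product multiply [v] by [a * b], which is nonzero, so the commutation sign is
    1. *)
Lemma eigen_commute f g v (a b : C) : (exists x, v x != 0) -> a != 0 -> b != 0 ->
  opapp (sigma f) v = vscale a v -> opapp (sigma g) v = vscale b v ->
  omega f g = 0.
Proof.
move=> [x vx] a0 b0 fv gv; apply: (@psign_inj C); rewrite psign0.
have: opapp (opmul (sigma f) (sigma g)) v x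
    = opapp (opscale (psign C (omega f g)) (opmul (sigma g) (sigma f))) v x.
  by rewrite sigma_comm.
rewrite opappZl !opappM gv fv !opappZr fv gv /vscale => e.
apply: (mulIf (mulf_neq0 a0 (mulf_neq0 b0 vx))).
by rewrite mul1r -e; ring.
Qed.

Lemma unit_vec_neq0 v : unit_vec v -> exists x, v x != 0.
Proof.
move=> v1; apply/existsP; apply: contra_eqT v1 => /existsPn v0.
rewrite big1 1?eq_sym ?oner_eq0 // => x _.
by rewrite (eqP (negbNE (v0 x))) mul0r.
Qed.

Lemma sign_eigen (a : C) : a = 1 \/ a = -1 -> a^* = a /\ a != 0.
Proof.
by case=> ->; rewrite ?rmorphN rmorph1 ?oppr_eq0 oner_eq0.
Qed.

(* The vector w' = <v,v> w - <v,w> v is orthogonal to every sigma(h) v: for h in S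
   because v is an eigenvector of sigma(h), for h outside S = perp S because
   some element of S anticommutes with sigma(h). *)
Lemma stabilized_unique S (eps : G Q -> C) v w : perp S = S -> (exists x, v x != 0) ->
  (forall f, f \in S -> eps f = 1 \/ eps f = -1) ->
  (forall f, f \in S -> opapp (sigma f) v = vscale (eps f) v) ->
  (forall f, f \in S -> opapp (sigma f) w = vscale (eps f) w) ->
  forall x, inner v v * w x = inner v w * v x.
Proof.
move=> Sperp v0 epsP vP wP x; apply/eqP; rewrite -subr_eq0; apply/eqP; move: x.
pose w' : Vec C Q := fun x => vscale (inner v v) w x - vscale (inner v w) v x.
have w'P f : f \in S -> opapp (sigma f) w' = vscale (eps f) w'.
  move=> Sf; apply: vec_ext => x.
  have -> : opapp (sigma f) w' x =
      opapp (sigma f) (vscale (inner v v) w) x - opapp (sigma f) (vscale (inner v w) v) x.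
    by rewrite /opapp -sumrB; apply: eq_bigr => y _; rewrite mulrBr.
  by rewrite !opappZr wP // vP // /w' /vscale; ring.
have vw' : inner v w' = 0 by rewrite innerBr !innerZr mulrC subrr.
apply: (pauli_cyclic v0 (w := w')) => h.
have [Sh|] := boolP (h \in S); first by rewrite w'P // innerZr vw' mulr0.
rewrite -{1}Sperp inE => /forall_inPn [g Sg hg].
have [eR e0] := sign_eigen (epsP g Sg).
(* Evaluated through [v], the left side is [eps g] times the inner product in question; moved across
   and past [sigma h], it is the negative of that. Hence the inner product is zero. *)
have : inner (opapp (sigma g) v) (opapp (sigma h) w') =
       - (eps g * inner v (opapp (sigma h) w')).
  rewrite -{1}(sigma_herm C g) -inner_adj -opappM sigma_comm omegaC psign_eqN1 //.
  by rewrite opappZl opappM w'P // opappZr !innerZr mulN1r.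
rewrite vP // innerZl eR => /eqP; rewrite -addr_eq0 -mulr2n mulrn_eq0 /=.
by rewrite mulf_eq0 (negPf e0) => /eqP.
Qed.

End StabilizerStates.

(** * The two directions of the equivalence *)

Section Equivalence.
Variables (C : numClosedFieldType) (M : finType) (n : nat) (party : 'I_n -> M).
Variables (psi psi' : Vec C 'I_n) (S S' : {set G 'I_n}).
Hypotheses (Spsi : stabilizer_state psi S) (Spsi' : stabilizer_state psi' S').
Local Notation restrG := (restrG party).
Local Notation PQ := (PQ party).

Lemma LCU_equiv_lin_iso : LCU_equiv party psi psi' ->
  exists T : G 'I_n -> G 'I_n, lin_iso S S' T /\
    forall f g al, omega (restrG (T f) al) (restrG (T g) al)
                   = omega (restrG f al) (restrG g al).
Proof.
move=> [U [Ucl [c [_ psiU]]]].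
have Uu al : unitary (U al) by case: (Ucl al).
have /fin_all_exists [u uP] al : exists u, forall f, intertwines (U al) f (u f).
  by have /cliffordE [_ /fin_all_exists [u uP]] := Ucl al; exists u.
pose T f := glue (fun al => u al (restrG f al)).
have TE f al : restrG (T f) al = u al (restrG f al) by apply: restrG_glue.
have Tloc f g al : omega (restrG (T f) al) (restrG (T g) al)
                   = omega (restrG f al) (restrG g al).
  by rewrite !TE; apply: intertwines_omega (uP al _) (uP al _).
have Tom f g : omega (T f) (T g) = omega f g.
  by rewrite !(omega_party party); apply: eq_bigr => al _.
have [[[_ _] Sperp] [psi1 [eps [epsP epsE]]]] := Spsi.
have [[[_ _] Sperp'] [psi1' [eps' [epsP' epsE']]]] := Spsi'.
(* The state [psi'] is an eigenvector of [sigma (T f)] and of each [sigma g] with [g] in [S']; so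
   [T f] is orthogonal to [S'] and lies in [perp S' = S']. *)
have TS f : f \in S -> T f \in S'.
  move=> Sf; rewrite -Sperp' inE; apply/forall_inP => g Sg; apply/eqP.
  have [b e] : intertwines (tens U) f (T f).
    by apply: tens_intertwines => al; rewrite TE.
  apply: (@eigen_commute C _ _ _ psi' ((-1) ^+ b * eps f) (eps' g)).
  - exact: unit_vec_neq0.
  - by rewrite mulf_neq0 ?signr_eq0 //; case: (sign_eigen (epsP f Sf)).
  - by case: (sign_eigen (epsP' g Sg)).
  - have -> : psi' = vscale c (opapp (tens U) psi) by apply: vec_ext.
    have epsf : opapp (sigma f) psi = vscale (eps f) psi.
      by apply: vec_ext => x; rewrite epsE.
    rewrite opappZr -opappM e opappZl opappM epsf opappZr.
    by apply: vec_ext => x; rewrite /vscale; ring.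
  by apply: vec_ext => x; rewrite epsE'.
exists T; split=> //; split=> [f g _ _|]; first exact: omega_additive.
split; first by move=> f g Sf Sg; apply: (omega_inj Tom).
apply/eqP; rewrite eqEsubset; apply/andP; split.
  by apply/subsetP => _ /imsetP [f Sf ->]; apply: TS.
(* For surjectivity, the preimage of [h] under the global bijection is orthogonal to [S], since [h]
   is orthogonal to the image of [S], and self-duality puts it in [S]. *)
have [T' _ TK] := injF_bij (omega_inj Tom).
apply/subsetP => h Sh; apply/imsetP; exists (T' h) => //.
rewrite -Sperp inE; apply/forall_inP => g Sg; rewrite -Tom TK.
by move: Sh; rewrite -{1}Sperp' inE => /forall_inP; apply; apply: TS.
Qed.

(** Each local vector is lifted to [S] by a chosen section [F], mapped by [T] and restricted
    again. *)
Lemma local_symplectic (T : G 'I_n -> G 'I_n) al :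
  self_dual S -> full_local_ranks party S ->
  self_dual S' -> full_local_ranks party S' -> T @: S = S' ->
  (forall f g, f \in S -> g \in S ->
     omega (restrG (T f) al) (restrG (T g) al) = omega (restrG f al) (restrG g al)) ->
  exists u : G (PQ al) -> G (PQ al),
    (forall k l, omega (u k) (u l) = omega k l) /\
    (forall f, f \in S -> u (restrG f al) = restrG (T f) al).
Proof.
move=> Sd Sloc Sd' Sloc' TS Tom.
have /fin_all_exists [F FP] (k : G (PQ al)) : exists f, f \in S /\ restrG f al = k.
  by have [f] := restrG_onto Sd Sloc k; exists f.
exists (fun k => restrG (T (F k)) al); split=> [k l|f Sf].
  have [Sk {2}<-] := FP k; have [Sl {2}<-] := FP l; exact: Tom.
have [Sk Ek] := FP (restrG f al).
(* Independence of the chosen lift: the difference of the two results pairs to zero with the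
   restrictions of all [T g], and these fill the local space because [S'] has full local ranks. *)
apply/eqP; rewrite -subr_eq0; apply/eqP/omega_nondeg => k.
have [g' Sg' <-] := restrG_onto Sd' Sloc' k; move: Sg'; rewrite -TS => /imsetP [g Sg ->].
by rewrite omegaDl omegaNl !Tom // Ek subrr.
Qed.

Lemma lin_iso_LCU_equiv (T : G 'I_n -> G 'I_n) :
  full_local_ranks party S -> full_local_ranks party S' -> T @: S = S' ->
  (forall f g, f \in S -> g \in S -> forall al,
     omega (restrG (T f) al) (restrG (T g) al) = omega (restrG f al) (restrG g al)) ->
  LCU_equiv party psi psi'.
Proof.
move=> Sloc Sloc' TS Tom.
have [Sd [psi1 [eps [epsP epsE]]]] := Spsi.
have [Sd' [psi1' [eps' [epsP' epsE']]]] := Spsi'.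
have /fin_all_exists [U UP] al : exists U : Op C (PQ al), clifford U /\
    forall f, f \in S -> intertwines U (restrG f al) (restrG (T f) al).
  have [u [uom uT]] := local_symplectic Sd Sloc Sd' Sloc' TS
    (fun f g Sf Sg => Tom f g Sf Sg al).
  have [U [Ucl Uu]] := clifford_lift C uom.
  by exists U; split=> // f Sf; rewrite -uT.
have Uu al : unitary (U al) by case: (UP al) => -[].
have psi0' := unit_vec_neq0 psi1'.
pose phi := opapp (tens U) psi.
have phi1 : inner phi phi = 1.
  by rewrite inner_unitary ?(unit_vecE psi).1 //; apply: tens_unitary.
(* Otherwise [phi] would vanish by [pauli_cyclic], contradicting its norm 1. *)
have [h psih] : exists h, inner psi' (opapp (sigma h) phi) != 0.
  have [/existsP //|/existsPn h0]
    := boolP [exists h, inner psi' (opapp (sigma h) phi) != 0].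
  have phi0 := pauli_cyclic psi0' (fun h => eqP (negbNE (h0 h))).
  move: phi1; rewrite /inner big1 => [/esym /eqP|x _]; first by rewrite oner_eq0.
  by rewrite phi0 mulr0.
(* The Pauli correction itself factors over the parties, so it is absorbed into the local
   Cliffords. *)
pose V al := opmul (sigma (restrG h al)) (U al).
have VE : tens V = opmul (sigma h) (tens U) by rewrite (sigma_tens _ party) tensM.
pose chi := opapp (tens V) psi.
have chi1 : inner chi chi = 1.
  rewrite /chi VE opappM inner_unitary //; exact: sigma_unitary.
have psichi : inner psi' chi != 0 by rewrite /chi VE opappM.
have psiE' g : g \in S' -> opapp (sigma g) psi' = vscale (eps' g) psi'.
  by move=> Sg; apply: vec_ext => x; rewrite epsE'.
have chiE g : g \in S' -> opapp (sigma g) chi = vscale (eps' g) chi.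
  move=> Sg; have := Sg; rewrite -TS => /imsetP [f Sf gE].
  have [b e] : intertwines (tens V) f g.
    rewrite VE gE; apply: intertwinesM (sigma_intertwines _ _ _).
    by apply: tens_intertwines => al; case: (UP al) => _; apply.
  have psiE : opapp (sigma f) psi = vscale (eps f) psi.
    by apply: vec_ext => x; rewrite epsE.
  have E : opapp (sigma g) chi = vscale ((-1) ^+ b * eps f) chi.
    rewrite /chi -opappM e opappZl opappM psiE opappZr.
    by apply: vec_ext => x; rewrite /vscale mulrA.
  (* Both eigenvalues of [sigma g] multiply the same nonzero inner product of [psi'] and [chi]. *)
  suff <- : (-1) ^+ b * eps f = eps' g by [].
  apply: (mulIf psichi); rewrite -innerZr -E inner_adj sigma_herm psiE' // innerZl.
  by case: (sign_eigen (epsP' g Sg)) => ->.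
have uniq := stabilized_unique Sd'.2 psi0' epsP' psiE' chiE.
move/unit_vecE: psi1' => psi1'; rewrite psi1' in uniq.
have chiZ : chi = vscale (inner psi' chi) psi'.
  by apply: vec_ext => x; rewrite /vscale -uniq mul1r.
have cc : (inner psi' chi)^* * inner psi' chi = 1.
  by move: chi1; rewrite {1 2}chiZ innerZl innerZr psi1' mulr1.
exists V; split=> [al|]; first by apply: cliffordM (clifford_sigma _ _) (UP al).1.
(* Both states are unit vectors, so the factor from [psi'] to [chi] has modulus 1 and its conjugate
   is its inverse. *)
exists (inner psi' chi)^*; split=> [|x].
  apply/eqP; rewrite norm_conjC -(@pexpr_eq1 _ _ 2) // normCK.
  by rewrite mulrC cc.
by rewrite -/chi {2}chiZ /vscale mulrA cc mul1r.
Qed.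

End Equivalence.

Theorem theorem1 (C : numClosedFieldType) (M : finType) (n : nat)
  (party : 'I_n -> M) (psi psi' : Vec C 'I_n) (S S' : {set G 'I_n}) :
  stabilizer_state psi S -> stabilizer_state psi' S' ->
  full_local_ranks party S -> full_local_ranks party S' ->
  (LCU_equiv party psi psi' <->
   exists T : G 'I_n -> G 'I_n,
     lin_iso S S' T /\
     forall f g, f \in S -> g \in S -> forall al : M,
       omega (restrG party (T f) al) (restrG party (T g) al)
       = omega (restrG party f al) (restrG party g al)).
Proof.
move=> Spsi Spsi' Sloc Sloc'; split=> [|[T [[_ [_ TS]] Tom]]].
  move=> /(LCU_equiv_lin_iso Spsi Spsi') [T [TS Tom]].
  by exists T; split=> // f g _ _ al; apply: Tom.
exact: (lin_iso_LCU_equiv Spsi Spsi' Sloc Sloc' TS Tom).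
Qed.
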